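(* Let $\Sigma$ be a finite alphabet. Every language over $\Sigma$ recognized by a system of linear recurrence equations with coefficients in $\mathcal{P}(\Sigma)$ is regular. Conversely, every regular language over $\Sigma$ is recognized by a system of linear recurrence equations with coefficients in $\mathcal{P}(\Sigma)$.
   Context: $\Sigma$ is a finite alphabet, $\Sigma^*$ is the set of finite words over $\Sigma$, and $\varepsilon$ is the empty word. The semiring of languages is $(\mathcal{P}(\Sigma^* ), \cup, \cdot, \emptyset, \{\varepsilon\})$, where $\mathcal{P}$ denotes the power set and $\cdot$ is concatenation of languages. $\mathcal{P}(\Sigma)$ is regarded as the subset of $\mathcal{P}(\Sigma^* )$ consisting of the languages all of whose words have length exactly 1 (sets of letters, including $\emptyset$). A system of linear recurrence equations with coefficients in $\mathcal{P}(\Sigma)$ is a system $$f_i(n+1) = \bigcup_{j=1}^k L_{ij} \cdot f_j(n), \quad f_i(0) = c_i, \quad 1 \le i \le k,$$ for functions $f_1, \ldots, f_k : \mathbb{N} \to \mathcal{P}(\Sigma^* )$ (with $0 \in \mathbb{N}$), where $k \ge 1$, $L_{ij} \in \mathcal{P}(\Sigma)$ for all $1 \le i,j \le k$, and each initial value $c_i$ is either $\emptyset$ or $\{\varepsilon\}$. The language recognized by the system is $\mathcal{L} = \bigcup_{n \in \mathbb{N}} f_1(n)$. The regular languages over $\Sigma = \{a_1, \ldots, a_m\}$ are the languages in the smallest class that contains $\emptyset, \{\varepsilon\}, \{a_1\}, \ldots, \{a_m\}$ and is closed under union, concatenation, and the Kleene star. *)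

(* Defs.v *)
From mathcomp Require Import all_boot.
From mathcomp Require Import boolp classical_sets.

Set Implicit Arguments.
Unset Strict Implicit.
Unset Printing Implicit Defensive.

Local Open Scope classical_set_scope.

Definition language (A : finType) := set (seq A).

Definition lang_eps (A : finType) : language A := [set [::]].
Arguments lang_eps : clear implicits.

Definition lang_letter (A : finType) (a : A) : language A := [set [:: a]].

Definition lang_cat (A : finType) (K L : language A) : language A :=
  [set u ++ v | u in K & v in L].

Definition lang_star (A : finType) (L : language A) : language A :=
  \bigcup_(n : nat) iter n (lang_cat L) (lang_eps A).

Inductive regular (A : finType) : language A -> Prop :=
| regular_empty : regular set0
| regular_eps : regular (lang_eps A)
| regular_letter (a : A) : regular (lang_letter a)
| regular_union (K L : language A) :
    regular K -> regular L -> regular (K `|` L)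
| regular_cat (K L : language A) :
    regular K -> regular L -> regular (lang_cat K L)
| regular_star (L : language A) : regular L -> regular (lang_star L).

(* P(Sigma), seen inside P(Sigma^* ) as the languages whose words all have
   length 1. *)
Definition letter_set (A : finType) (L : language A) : Prop :=
  L `<=` [set w | size w = 1].

(* The k >= 1 unknowns f_1, ..., f_k of a system are indexed by 'I_m.+1 with
   m.+1 = k, so that f_1 is f ord0. *)
Record lin_rec_system (A : finType) (m : nat) := LinRecSystem {
  coeff : 'I_m.+1 -> 'I_m.+1 -> language A;
  init : 'I_m.+1 -> language A;
  coeff_letters : forall i j, letter_set (coeff i j);
  init_01 : forall i, init i = set0 \/ init i = lang_eps A
}.

Definition solves (A : finType) (m : nat) (S : lin_rec_system A m)
    (f : 'I_m.+1 -> nat -> language A) : Prop :=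
  (forall i n,
     f i n.+1 = \bigcup_(j : 'I_m.+1) lang_cat (coeff S i j) (f j n)) /\
  (forall i, f i 0 = init S i).

Definition recognized (A : finType) (L : language A) : Prop :=
  exists (m : nat) (S : lin_rec_system A m) (f : 'I_m.+1 -> nat -> language A),
    solves S f /\ L = \bigcup_(n : nat) f ord0 n.

(* Main.v *)
Require Import Defs.
From mathcomp Require Import all_boot.
From mathcomp Require Import boolp classical_sets.

(** Recognized implies regular: the total languages [X i], the union of the
    [f i n] over [n], satisfy the fixpoint equations
    [X i = init i + sum_j coeff i j . X j], whose coefficients do not contain
    the empty word. Arden's lemma ([X = A X + B] forces [X = A^* B]) eliminates
    the unknowns one at a time, keeping all coefficients regular.

    Regular implies recognized: by induction on the regular language [L], there
    is a finite family of languages such that [L], and every left quotient by a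
    letter of a member of the family, is a union of members (Antimirov's partial
    derivatives). The words of length [n] in the members of such a family,
    with [L] itself added as first member, solve a system of the required form. *)

Set Implicit Arguments.
Unset Strict Implicit.
Unset Printing Implicit Defensive.

Local Open Scope classical_set_scope.

Section LanguageAlgebra.
Variable A : finType.
Implicit Types K L M : language A.

(** * Concatenation, star and Arden's lemma *)

Lemma lang_catE K L u v : K u -> L v -> lang_cat K L (u ++ v).
Proof. by move=> Ku Lv; exists u => //; exists v. Qed.

Lemma lang_catS K K' L L' :
  K `<=` K' -> L `<=` L' -> lang_cat K L `<=` lang_cat K' L'.
Proof.
by move=> sK sL _ [u Ku [v Lv <-]]; apply: lang_catE; [exact: sK|exact: sL].
Qed.

Lemma lang_catA K L M : lang_cat K (lang_cat L M) = lang_cat (lang_cat K L) M.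
Proof.
apply/seteqP; split.
  move=> _ [u Ku [_ [v Lv [w Mw <-]] <-]]; rewrite catA.
  by do 2! [apply: lang_catE => //].
move=> _ [_ [u Ku [v Lv <-]] [w Mw <-]]; rewrite -catA.
by do 2! [apply: lang_catE => //].
Qed.

Lemma lang_catUl K L M : lang_cat (K `|` L) M = lang_cat K M `|` lang_cat L M.
Proof.
apply/seteqP; split; last by rewrite subUset; split; apply: lang_catS.
by move=> _ [u [Ku|Lu] [v Mv <-]]; [left|right]; apply: lang_catE.
Qed.

Lemma lang_catUr K L M : lang_cat K (L `|` M) = lang_cat K L `|` lang_cat K M.
Proof.
apply/seteqP; split; last by rewrite subUset; split; apply: lang_catS.
by move=> _ [u Ku [v [Lv|Mv] <-]]; [left|right]; apply: lang_catE.
Qed.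

Lemma lang_cat_bigcupr I K (F : I -> language A) :
  lang_cat K (\bigcup_i F i) = \bigcup_i lang_cat K (F i).
Proof.
apply/seteqP; split.
  by move=> _ [u Ku [v [i _ Fv] <-]]; exists i => //; apply: lang_catE.
by move=> _ [i _ [u Ku [v Fv <-]]]; apply: lang_catE => //; exists i.
Qed.

Lemma bigcup_ordS n (F : 'I_n.+1 -> language A) :
  \bigcup_i F i = F ord0 `|` \bigcup_i F (lift ord0 i).
Proof.
apply/seteqP; split=> [w [i _]|w [F0|[i _ Fi]]]; last first.
- by exists (lift ord0 i).
- by exists ord0.
by case: (unliftP ord0 i) => [j|] -> Fw; [right; exists j|left].
Qed.

Lemma lang_star_nil L : lang_star L [::].
Proof. by exists 0. Qed.

Lemma lang_star_cat L : lang_cat L (lang_star L) `<=` lang_star L.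
Proof. by move=> _ [u Lu [v [n _ Lv] <-]]; exists n.+1 => //; apply: lang_catE. Qed.

(** Empty factors are skipped until the first nonempty one, which must begin with [a]. *)
Lemma lang_star_cons L a w :
  lang_star L (a :: w) ->
  exists u v, [/\ w = u ++ v, L (a :: u) & lang_star L v].
Proof.
case=> n _; elim: n => [|n IHn] //= [[|b u] Lu [v Lv]].
  by move=> /= e; rewrite e in Lv; exact: IHn.
by case=> <- <-; exists u, v; split=> //; exists n.
Qed.

(** Each unfolding of [X] through [K] strips a nonempty prefix, so induction on word length ends in
    [L]. Conversely, induction on the power of [K] puts every word of [K^* L] in [X]. *)
Lemma arden K L X :
  ~ K [::] -> X = L `|` lang_cat K X -> X = lang_cat (lang_star K) L.
Proof.
move=> K0 eX; apply/seteqP; split.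
  suff sub n w : size w <= n -> X w -> lang_cat (lang_star K) L w.
    by move=> w; apply: (sub (size w)).
  elim: n w => [|n IHn] w le_wn; rewrite {1}eX => -[Lw|].
  - exact: (lang_catE (lang_star_nil K) Lw).
  - by case=> [[|a u] //= Ku [v _ e]]; rewrite -e in le_wn.
  - exact: (lang_catE (lang_star_nil K) Lw).
  - case=> [[|a u] //= Ku [v Xv e]]; rewrite -{}e /= ltnS size_cat in le_wn *.
    have /IHn/(_ Xv) : size v <= n by apply: leq_trans le_wn; exact: leq_addl.
    move=> /(lang_catE Ku); rewrite lang_catA.
    by apply: (lang_catS _ (@subset_refl _ _)); exact: lang_star_cat.
move=> _ [u [n _ Ku] [v Lv <-]]; elim: n u Ku => [|n IHn] u /=.
  by move=> ->; rewrite eX; left.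
by case=> u1 Ku1 [u2 /IHn Xu2 <-]; rewrite eX -catA; right; apply: lang_catE.
Qed.

(** * Solving linear systems over regular languages *)

Lemma regular_bigcup n (F : 'I_n -> language A) :
  (forall i, regular (F i)) -> regular (\bigcup_i F i).
Proof.
elim: n F => [|n IHn] F rF.
  suff -> : \bigcup_i F i = set0 by exact: regular_empty.
  by apply/seteqP; split=> // w [[]].
by rewrite bigcup_ordS; apply: regular_union => //; apply: IHn.
Qed.

Lemma regular_letter_set L : letter_set L -> regular L.
Proof.
move=> L1.
have -> : L = \bigcup_(i : 'I_#|A|) (lang_letter (enum_val i) `&` L).
  apply/seteqP; split=> [w Lw|w [i _ []] //].
  have := L1 _ Lw; case: w Lw => [|a [|]] //= La _.
  by exists (enum_rank a) => //; split=> //; rewrite /lang_letter enum_rankK.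
apply: regular_bigcup => i; have [La|nLa] := pselect (L [:: enum_val i]).
  rewrite (_ : _ `&` _ = lang_letter (enum_val i)); first exact: regular_letter.
  by apply/seteqP; split=> [w []//|w ->]; split.
rewrite (_ : _ `&` _ = set0); first exact: regular_empty.
by apply/seteqP; split=> // w [-> /nLa].
Qed.

(** Gaussian elimination: Arden's lemma expresses [X ord0] through the other unknowns, and
    substituting it leaves a system with one unknown fewer. *)
Lemma regular_linear_solution n (K : 'I_n -> 'I_n -> language A)
    (B X : 'I_n -> language A) :
    (forall i j, regular (K i j)) -> (forall i j, ~ K i j [::]) ->
    (forall i, regular (B i)) ->
    (forall i, X i = B i `|` \bigcup_j lang_cat (K i j) (X j)) ->
  forall i, regular (X i).
Proof.
elim: n K B X => [|n IHn] K B X rK K0 rB eX; first by case.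
pose s := lift (@ord0 n); pose S := lang_star (K ord0 ord0).
have eX0 : X ord0 = lang_cat S (B ord0 `|` \bigcup_j lang_cat (K ord0 (s j)) (X (s j))).
  apply: arden; first exact: K0.
  by rewrite {1}eX bigcup_ordS -setUA; congr (_ `|` _); exact: setUC.
have rS : regular S by apply: regular_star.
have rXs : forall i, regular (X (s i)).
  apply: (IHn (fun i j => K (s i) (s j)
                 `|` lang_cat (lang_cat (K (s i) ord0) S) (K ord0 (s j)))
              (fun i => B (s i) `|` lang_cat (lang_cat (K (s i) ord0) S) (B ord0))).
  - by move=> i j; apply: regular_union => //; do 2! [apply: regular_cat => //].
  (* The new coefficients still avoid the empty word: the leftmost factor [K (s i) ord0] of the
     product does. *)
  - move=> i j [/K0//|[_ [u Ku [v _ <-]] [w _]]].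
    by case: u Ku => [/K0|].
  - by move=> i; apply: regular_union => //; do 2! [apply: regular_cat => //].
  move=> i; rewrite {1}eX bigcup_ordS eX0 lang_catA lang_catUr lang_cat_bigcupr.
  rewrite -!setUA; do 2 congr (_ `|` _); rewrite setUC -bigcupU.
  by apply: eq_bigcupr => j _; rewrite lang_catUl lang_catA.
move=> i; case: (unliftP ord0 i) => [j|] ->; first exact: rXs.
rewrite eX0; apply: regular_cat => //; apply: regular_union => //.
by apply: regular_bigcup => j; apply: regular_cat.
Qed.

Lemma recognized_regular L : recognized L -> regular L.
Proof.
case=> m [S [f [[fS f0] ->]]].
apply: (regular_linear_solution (K := coeff S) (B := init S)
                                (X := fun i => \bigcup_n f i n)).
- by move=> i j; apply: regular_letter_set; exact: coeff_letters.
- by move=> i j /coeff_letters.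
- by move=> i; case: (init_01 S i) => ->; [exact: regular_empty|exact: regular_eps].
move=> i; apply/seteqP; split.
  (* Index 0 yields the constant term, successor indices the linear part. *)
  move=> w [[|n] _]; first by rewrite f0; left.
  rewrite fS => -[j _ [u Ku [v fv <-]]]; right; exists j => //.
  by apply: lang_catE => //; exists n.
move=> w [|[j _ [u Ku [v [n _ fv] <-]]]]; first by rewrite -f0; exists 0.
by exists n.+1 => //; rewrite fS; exists j => //; apply: lang_catE.
Qed.

(** * Finite families closed under left quotients *)

Definition quotient (a : A) L : language A := [set w | L (a :: w)].

(* [L] is a union of members of [X]; the largest such union is taken, which
   spares a choice of index set. *)
Definition covers (Q : Type) (X : Q -> language A) L : Prop :=
  forall w, L w -> exists2 j, X j w & X j `<=` L.

Definition quotient_closed (Q : Type) (X : Q -> language A) : Prop :=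
  forall q a, covers X (quotient a (X q)).

Definition finitely_derived L : Prop :=
  exists (Q : finType) (X : Q -> language A), quotient_closed X /\ covers X L.

Section Covers.
Variables (Q : Type) (X : Q -> language A).

Lemma coversU K L : covers X K -> covers X L -> covers X (K `|` L).
Proof.
by move=> cK cL w [/cK|/cL] [j Xj sj]; exists j => // v /sj; [left|right].
Qed.

Lemma covers_quotient a L :
  quotient_closed X -> covers X L -> covers X (quotient a L).
Proof.
move=> cX cL w /cL[j Xj sj]; have [k Xk sk] := cX j a w Xj.
by exists k => // v /sk /sj.
Qed.

Lemma covers_cat K L :
  covers X K -> covers (fun j => lang_cat (X j) L) (lang_cat K L).
Proof.
move=> cK _ [u /cK[j Xj sj] [v Lv <-]]; exists j; first exact: lang_catE.
exact: lang_catS.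
Qed.

Lemma covers_reindex (P : Type) (h : P -> Q) L : covers (X \o h) L -> covers X L.
Proof. by move=> cL w /cL[j]; exists (h j). Qed.

(** Serves the term of [quotient_cat] that is present only when [K [::]] holds. *)
Lemma covers_guard (P : Prop) L :
  (P -> covers X L) -> covers X [set w | P /\ L w].
Proof. by move=> cL w [p /(cL p)[j Xj sj]]; exists j => // v /sj. Qed.

End Covers.

(** The letter [a] comes from the left factor, or from the right one if the left factor contributes
    the empty word. *)
Lemma quotient_cat a K L :
  quotient a (lang_cat K L) =
  lang_cat (quotient a K) L `|` [set w | K [::] /\ quotient a L w].
Proof.
apply/seteqP; split.
  move=> w [[|b u] Ku [v Lv]] /=; first by move=> e; right; rewrite /quotient /= -e.
  by case=> eb <-; left; apply: lang_catE => //; rewrite /quotient /= -eb.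
move=> w [[u Ku [v Lv <-]]|[K0 Lw]]; first exact: (lang_catE (u := a :: u) Ku Lv).
exact: (lang_catE (v := a :: w) K0 Lw).
Qed.

Lemma quotient_star a L :
  quotient a (lang_star L) = lang_cat (quotient a L) (lang_star L).
Proof.
apply/seteqP; split=> [w /lang_star_cons[u [v [-> Lu Lv]]]|_ [u Lu [v Lv <-]]].
  exact: lang_catE.
exact: (lang_star_cat (lang_catE (u := a :: u) Lu Lv)).
Qed.

Lemma finitely_derived_empty : finitely_derived set0.
Proof. by exists void, (fun=> set0); split=> [[]|]. Qed.

Lemma finitely_derived_eps : finitely_derived (lang_eps A).
Proof. by exists unit, (fun=> lang_eps A); split=> // w; exists tt. Qed.

Lemma finitely_derived_letter (a : A) : finitely_derived (lang_letter a).
Proof.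
exists bool, (fun b => if b then lang_letter a else lang_eps A).
split=> [[] b|]; [|by []|by move=> w ?; exists true].
by move=> w [-> ->]; exists false => // _ ->.
Qed.

Lemma finitely_derived_union K L :
  finitely_derived K -> finitely_derived L -> finitely_derived (K `|` L).
Proof.
case=> [P [X [cX cK]]] [Q [Y [cY cL]]].
exists (P + Q)%type, (fun s => match s with inl p => X p | inr q => Y q end).
split=> [[p|q] a|]; first exact: (covers_reindex (h := inl) (cX p a)).
  exact: (covers_reindex (h := inr) (cY q a)).
apply: coversU; first exact: (covers_reindex (h := inl) cK).
exact: (covers_reindex (h := inr) cL).
Qed.

Lemma finitely_derived_cat K L :
  finitely_derived K -> finitely_derived L -> finitely_derived (lang_cat K L).
Proof.
case=> [P [X [cX cK]]] [Q [Y [cY cL]]].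
(* Members [inl p] are still reading the left factor; members [inr q] have moved on to [L]. *)
exists (P + Q)%type,
  (fun s => match s with inl p => lang_cat (X p) L | inr q => Y q end).
split=> [[p|q] a|].
- rewrite quotient_cat; apply: coversU.
    by apply: (covers_reindex (h := inl)); apply: covers_cat; exact: cX.
  apply: covers_guard => _; apply: (covers_reindex (h := inr)).
  exact: covers_quotient.
- exact: (covers_reindex (h := inr) (cY q a)).
- by apply: (covers_reindex (h := inl)); exact: covers_cat.
Qed.

Lemma finitely_derived_star L :
  finitely_derived L -> finitely_derived (lang_star L).
Proof.
case=> [Q [X [cX cL]]].
(* [None] covers the empty word of the star; the products [Some q] cover its nonempty words. *)
exists (option Q),
  (fun s => if s is Some q then lang_cat (X q) (lang_star L) else lang_eps A).
have cLS a := covers_cat (L := lang_star L) (covers_quotient (a := a) cX cL).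
split=> [[q|] a|]; [|by []|].
- rewrite quotient_cat quotient_star; apply: coversU.
    by apply: (covers_reindex (h := Some)); apply: covers_cat; exact: cX.
  by apply: covers_guard => _; apply: (covers_reindex (h := Some)); exact: cLS.
move=> [_|a w Lw]; first by exists None => // _ ->; exact: lang_star_nil.
have [u [v [-> Lu Lv]]] := lang_star_cons Lw.
have [q Xq sq] := cL _ Lu.
exists (Some q); first exact: (lang_catE Xq Lv).
by move=> x /(lang_catS sq (@subset_refl _ _)); exact: lang_star_cat.
Qed.

Lemma regular_finitely_derived L : regular L -> finitely_derived L.
Proof.
elim=> {L} [||a|K L _ ? _ ?|K L _ ? _ ?|L _ ?].
- exact: finitely_derived_empty.
- exact: finitely_derived_eps.
- exact: finitely_derived_letter.
- exact: finitely_derived_union.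
- exact: finitely_derived_cat.
- exact: finitely_derived_star.
Qed.

(** * From a closed family to a recurrence system *)

(** The letters labelling transitions from [i] to [j] in a nondeterministic automaton where state
    [i] is meant to accept [X i]; every transition compatible with this is allowed. *)
Definition quotient_coeff m (X : 'I_m.+1 -> language A) (i j : 'I_m.+1) :
    language A :=
  [set w | exists2 a, w = [:: a] & X j `<=` quotient a (X i)].

Lemma quotient_coeff_letters m (X : 'I_m.+1 -> language A) i j :
  letter_set (quotient_coeff X i j).
Proof. by move=> _ [a ->]. Qed.

Lemma nil_part_01 L : L `&` lang_eps A = set0 \/ L `&` lang_eps A = lang_eps A.
Proof.
have [L0|nL0] := pselect (L [::]); [right|left].
  by apply/seteqP; split=> [w []//|w ->].
by apply/seteqP; split=> // w [/[swap] ->].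
Qed.

Definition quotient_system m (X : 'I_m.+1 -> language A) : lin_rec_system A m :=
  LinRecSystem (@quotient_coeff_letters m X) (fun i => nil_part_01 (X i)).

Lemma quotient_system_solves m (X : 'I_m.+1 -> language A) :
  quotient_closed X ->
  solves (quotient_system X) (fun i n => X i `&` [set w | size w = n]).
Proof.
move=> cX; split=> [i n|i] /=; last first.
  by congr (_ `&` _); apply/seteqP; split=> w; [exact: size0nil|move=> ->].
apply/seteqP; split=> [[|a w] [] //= Xw [sw]|].
  (* Closedness supplies a transition reading the first letter; the reverse inclusion is built into
     the coefficients. *)
  have [j Xj sj] := cX i a w Xw.
  by exists j => //; exists [:: a]; [exists a|exists w].
by move=> _ [j _ [_ [a -> sj] [v [Xv /= <-] <-]]]; split=> //; exact: (sj v Xv).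
Qed.

Lemma regular_recognized L : regular L -> recognized L.
Proof.
case/regular_finitely_derived=> Q [X [cX cL]].
(* [L] takes index [ord0], the unknown from which the recognized language is read. The family stays
   closed since quotients of [L] are already covered by [X]. *)
pose Y (i : 'I_#|Q|.+1) := if unlift ord0 i is Some j then X (enum_val j) else L.
have Y0 : Y ord0 = L by rewrite /Y unlift_none.
have YS j : Y (lift ord0 (enum_rank j)) = X j by rewrite /Y liftK enum_rankK.
have cY M : covers X M -> covers Y M.
  by move=> cM w /cM[j]; exists (lift ord0 (enum_rank j)); rewrite YS.
exists #|Q|, (quotient_system Y), (fun i n => Y i `&` [set w | size w = n]); split.
  apply: quotient_system_solves => i a; apply: cY.
  by rewrite /Y; case: unliftP => [j _|_]; [exact: cX|exact: covers_quotient].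
rewrite Y0; apply/seteqP; split=> [w Lw|w [n _ []] //].
by exists (size w).
Qed.

End LanguageAlgebra.

Theorem theorem4p3 (Sigma : finType) :
  (forall L : language Sigma, recognized L -> regular L) /\
  (forall L : language Sigma, regular L -> recognized L).
Proof.
by split=> L; [exact: recognized_regular|exact: regular_recognized].
Qed.
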